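(* Let $\Delta_n$ ($n\ge 0$) be as defined in the context. Then, as an identity of power series (convergent in a neighborhood of $t=0$), $$f(t):=\sum_{n\ge 0}\Delta_n (2t)^n=\frac12\,\frac{1}{\sqrt{(1-t)(1-2t)(2t^2+t+1)}}-\frac12\,\frac{1}{1-t},$$ where the square root is the branch equal to $1$ at $t=0$.
   Context: A fair coin is flipped $n$ times, producing a sequence $x_1,\dots,x_n\in\{H,T\}$ of independent uniformly random outcomes. Alice's score is the number of indices $i\in\{1,\dots,n-1\}$ with $(x_i,x_{i+1})=(H,H)$; Bob's score is the number of indices $i\in\{1,\dots,n-1\}$ with $(x_i,x_{i+1})=(H,T)$. Let $P_n(\mathrm{Bob})$ be the probability that Bob's score is strictly larger than Alice's, $P_n(\mathrm{Alice})$ the probability that Alice's score is strictly larger than Bob's, and $\Delta_n=P_n(\mathrm{Bob})-P_n(\mathrm{Alice})$ (so $\Delta_0=0$). *)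

(* Defs.v *)
From mathcomp Require Import all_boot.
From Stdlib Require Import Reals.
From Coquelicot Require Import Coquelicot.

(* Coin outcomes: true = H, false = T. *)

Definition adj_pairs (s : seq bool) : seq (bool * bool) := zip s (behead s).

Definition alice_score (s : seq bool) : nat :=
  count (fun p : bool * bool => p.1 && p.2) (adj_pairs s).

Definition bob_score (s : seq bool) : nat :=
  count (fun p : bool * bool => p.1 && ~~ p.2) (adj_pairs s).

Definition P_bob (n : nat) : R :=
  (INR #|[set t : n.-tuple bool | ltn (alice_score t) (bob_score t)]| / pow 2 n)%R.

Definition P_alice (n : nat) : R :=
  (INR #|[set t : n.-tuple bool | ltn (bob_score t) (alice_score t)]| / pow 2 n)%R.

Definition Delta_n (n : nat) : R := (P_bob n - P_alice n)%R.

(* Main.v *)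
Require Import Defs.
From mathcomp Require Import all_boot.
From Stdlib Require Import Reals ZArith Lia Lra.
From Coquelicot Require Import Coquelicot.

(** Let [sign_sum b n j] be the sum, over the words [u] of length [n], of the
    sign of [j] plus the score gap (Bob minus Alice) of the word [b :: u].  A
    leading tail never scores, so [2 ^ n * Delta_n n = sign_sum false n 0].
    Conditioning on the first letter of [u] shows that the generating functions
    [V b j] of [sign_sum b n j] satisfy the linear system
    [V b j = sgn j + t (V true (j + gap_step b true) + V false (j + gap_step b false))].
    For [|t| < 1/2] the system is a contraction, so every bounded solution is the
    sum of these series.  A bounded solution is found by hand: for [j > 0] and
    [j < 0] it is [1/(1-2t)], respectively [-1/(1-2t)], plus a term geometric in [j]
    whose ratio solves a quadratic equation of discriminant
    [(1-t)(1-2t)(2t^2+t+1)]. *)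

Definition score_gap (s : seq bool) : Z :=
  (Z.of_nat (bob_score s) - Z.of_nat (alice_score s))%Z.

Definition gap_step (b c : bool) : Z :=
  (if b then if c then -1 else 1 else 0)%Z.

Lemma score_gap_cons2 (b c : bool) (s : seq bool) :
  score_gap (b :: c :: s) = (gap_step b c + score_gap (c :: s))%Z.
Proof.
rewrite /score_gap /bob_score /alice_score /adj_pairs /=.
rewrite -!plusE !Nat2Z.inj_add.
set x := Z.of_nat (count _ _); set y := Z.of_nat (count _ _).
move: x y; case: b; case: c => x y; cbn [nat_of_bool andb negb Z.of_nat gap_step]; lia.
Qed.

Lemma score_gap_false (s : seq bool) : score_gap (false :: s) = score_gap s.
Proof. by case: s => [|c s] //; rewrite score_gap_cons2. Qed.

Lemma card_tuple0 (P : pred (seq bool)) :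
  #|[set u : 0.-tuple bool | P u]| = nat_of_bool (P [::]).
Proof.
rewrite -sum1dep_card (eq_bigl (fun=> P [::])) => [|u]; last by rewrite tuple0.
case: (P [::]); last by rewrite big_pred0.
by rewrite sum1_card card_tuple expn0.
Qed.

Lemma card_tupleS (n : nat) (P : pred (seq bool)) :
  #|[set u : n.+1.-tuple bool | P u]| =
  (#|[set u : n.-tuple bool | P (true :: u)]|
   + #|[set u : n.-tuple bool | P (false :: u)]|)%nat.
Proof.
rewrite -!sum1dep_card.
rewrite (reindex (fun p : bool * n.-tuple bool => [tuple of p.1 :: p.2])) /=.
  rewrite big_mkcond -(pair_bigA _ (fun b (u : n.-tuple bool) =>
    if P (b :: u) then 1%nat else 0%nat)) /=.
  by rewrite big_bool -!big_mkcond.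
exists (fun u => (thead u, [tuple of behead u])) => [[b u] _ | u _] /=.
  by congr (_, _); exact: val_inj.
by case/tupleP: u => b u; exact: val_inj.
Qed.

(** The last letter read, [b], and the gap so far, [j], are all that the future of a word depends
    on; keeping both general closes the recurrence. *)
Definition sign_sum (b : bool) (n : nat) (j : Z) : R :=
  (INR #|[set u : n.-tuple bool | Z.ltb 0 (j + score_gap (b :: u))]|
   - INR #|[set u : n.-tuple bool | Z.ltb (j + score_gap (b :: u)) 0]|)%R.

Lemma sign_sum0 (b : bool) (j : Z) : sign_sum b 0 j = IZR (Z.sgn j).
Proof.
rewrite /sign_sum (card_tuple0 (fun u => Z.ltb 0 (j + score_gap (b :: u)))).
rewrite (card_tuple0 (fun u => Z.ltb (j + score_gap (b :: u)) 0)).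
have -> : score_gap [:: b] = 0%Z by [].
by rewrite Z.add_0_r; case: j => [|p|p] /=; lra.
Qed.

Lemma sign_sumS (b : bool) (n : nat) (j : Z) :
  sign_sum b n.+1 j = (sign_sum true n (j + gap_step b true)
                       + sign_sum false n (j + gap_step b false))%R.
Proof.
have cardE (p : Z -> bool) :
    #|[set u : n.+1.-tuple bool | p (j + score_gap (b :: u))%Z]| =
    (#|[set u : n.-tuple bool | p (j + gap_step b true + score_gap (true :: u))%Z]|
     + #|[set u : n.-tuple bool | p (j + gap_step b false + score_gap (false :: u))%Z]|)%nat.
  rewrite (card_tupleS n (fun u => p (j + score_gap (b :: u))%Z)).
  by congr (_ + _)%nat; apply: eq_card => u; rewrite !inE score_gap_cons2 Z.add_assoc.
rewrite /sign_sum (cardE (Z.ltb 0)) (cardE (fun k => Z.ltb k 0)).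
rewrite !plus_INR; lra.
Qed.

Lemma Delta_sign_sum (n : nat) : Delta_n n = (sign_sum false n 0 / 2 ^ n)%R.
Proof.
have lt1 (u : n.-tuple bool) : Z.ltb 0 (0 + score_gap (false :: u)) = ltn (alice_score u) (bob_score u).
  rewrite score_gap_false /score_gap.
  by apply/idP/idP => [/Z.ltb_spec0 ?|/ltP ?]; [apply/ltP | apply/Z.ltb_spec0]; lia.
have lt2 (u : n.-tuple bool) : Z.ltb (0 + score_gap (false :: u)) 0 = ltn (bob_score u) (alice_score u).
  rewrite score_gap_false /score_gap.
  by apply/idP/idP => [/Z.ltb_spec0 ?|/ltP ?]; [apply/ltP | apply/Z.ltb_spec0]; lia.
rewrite /sign_sum (eq_finset _ lt1) (eq_finset _ lt2) /Delta_n /P_bob /P_alice.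
rewrite /Rdiv; ring.
Qed.

Local Open Scope R_scope.

(* One step of the expansion costs a factor [2 |t|], since each equation has two terms. *)
Lemma sign_sum_remainder (t K : R) (V : bool -> Z -> R) :
  (forall b j, Rabs (V b j) <= K) ->
  (forall b j, V b j = IZR (Z.sgn j)
     + t * (V true (j + gap_step b true)%Z + V false (j + gap_step b false)%Z)) ->
  forall n b j,
    Rabs (V b j - sum_n (fun m => sign_sum b m j * t ^ m) n)
    <= K * (2 * Rabs t) ^ n.+1.
Proof.
move=> Vbnd Veq.
have step (x y : R) (E : R) : Rabs x <= E -> Rabs y <= E ->
    Rabs (t * (x + y)) <= 2 * Rabs t * E.
  move=> hx hy; rewrite Rabs_mult.
  have := Rabs_triang x y; have := Rabs_pos t; nra.
elim=> [|n IH] b j.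
  rewrite sum_O sign_sum0 Veq.
  set x := V _ _; set y := V _ _.
  have -> : IZR (Z.sgn j) + t * (x + y) - IZR (Z.sgn j) * t ^ 0 = t * (x + y)
    by rewrite /=; ring.
  by have := step x y K (Vbnd _ _) (Vbnd _ _); rewrite /=; lra.
have -> : sum_n (fun m => sign_sum b m j * t ^ m) n.+1 = IZR (Z.sgn j)
    + t * (sum_n (fun m => sign_sum true m (j + gap_step b true) * t ^ m) n
           + sum_n (fun m => sign_sum false m (j + gap_step b false) * t ^ m) n).
  (* The term [m = 0] is the sign; the later ones, shifted by one, give [t] times the partial sums
     of the two successor states. *)
  rewrite [LHS]/sum_n sum_Sn_m; last exact/leP.
  have shift : sum_n_m (fun m => sign_sum b m j * t ^ m) 1 n.+1
      = sum_n (fun m => t * (sign_sum true m (j + gap_step b true) * t ^ m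
                            + sign_sum false m (j + gap_step b false) * t ^ m)) n.
    rewrite -sum_n_m_S; apply: sum_n_ext => m.
    rewrite sign_sumS /=; ring.
  rewrite shift sign_sum0 sum_n_mult_l sum_n_plus /plus /mult /=.
  by rewrite Rmult_1_r.
rewrite Veq.
set x := V _ _; set y := V _ _; set X := sum_n _ _; set Y := sum_n _ _.
have -> : IZR (Z.sgn j) + t * (x + y) - (IZR (Z.sgn j) + t * (X + Y))
    = t * ((x - X) + (y - Y)) by ring.
have := step (x - X) (y - Y) _ (IH true _) (IH false _).
rewrite /=; lra.
Qed.

(** Since [2 * Rabs t < 1], the remainder bound tends to 0, so exhibiting one bounded solution of
    the system sums the series. *)
Lemma sign_sum_series (t K : R) (V : bool -> Z -> R) (b : bool) (j : Z) :
  Rabs t < / 2 ->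
  (forall b j, Rabs (V b j) <= K) ->
  (forall b j, V b j = IZR (Z.sgn j)
     + t * (V true (j + gap_step b true)%Z + V false (j + gap_step b false)%Z)) ->
  is_series (fun n => sign_sum b n j * t ^ n) (V b j).
Proof.
move=> ht Vbnd Veq.
set S := sum_n (fun n => sign_sum b n j * t ^ n).
have cvg0 : is_lim_seq (fun n => V b j - S n) 0.
  apply/is_lim_seq_abs_0.
  apply: (is_lim_seq_le_le (fun _ => 0) _ (fun n => K * (2 * Rabs t) ^ n.+1)).
  - move=> n; split; first exact: Rabs_pos.
    exact: sign_sum_remainder.
  - exact: is_lim_seq_const.
  - have -> : Finite 0 = Rbar_mult K 0 by rewrite /= Rmult_0_r.
    apply: is_lim_seq_scal_l.
    apply/(is_lim_seq_incr_1 (fun n => (2 * Rabs t) ^ n)); apply: is_lim_seq_geom.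
    have t0 := Rabs_pos t; rewrite (Rabs_pos_eq (2 * Rabs t)); lra.
change (is_lim_seq S (V b j)).
apply: (is_lim_seq_ext (fun n => V b j - (V b j - S n))) => [n|]; first by rewrite /S; ring.
rewrite -[X in is_lim_seq _ (Finite X)]Rminus_0_r.
by apply: is_lim_seq_minus' cvg0; exact: is_lim_seq_const.
Qed.

(* Here [t q] is the small root of [t^2 x^2 - (1 - t) x + t (1 - t)], which
   governs the solution for [j >= 0], and [t^2 q / (1 - t)] is the inverse of
   the other root, which governs it for [j < 0]; the constants are forced by the
   equations at [j = 0] and [j = -1]. *)
Lemma sign_potential (t s q : R) :
  Rabs t < / 4 -> 0 < s -> 0 < q <= 2 ->
  s = 1 - t - 2 * t ^ 3 * q -> t ^ 3 * q ^ 2 = (1 - t) * (q - 1) ->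
  exists (V : bool -> Z -> R) (K : R),
    [/\ forall b j, Rabs (V b j) <= K,
        forall b j, V b j = IZR (Z.sgn j)
          + t * (V true (j + gap_step b true)%Z + V false (j + gap_step b false)%Z)
      & V false 0%Z = t ^ 3 * q / ((1 - t) * s)].
Proof.
move=> /Rabs_lt_between ht s0 hq sE qE.
set c := / (1 - 2 * t).
set p := t ^ 2 * q / s.
set rho := t * q.
set tau := t ^ 2 * q / (1 - t).
set be := q * t * (c + t * p / (1 - t)).
(* [phi] is [V true]. Its value at 0 is [p], fixed by the equation there; [be] makes
   [phi (-1) = - c + be] satisfy the equation at [-1], and the exponent [- j - 1] starts the
   negative branch at power 0. *)
pose phi (j : Z) : R :=
  if Z.leb 0 j then c + (p - c) * rho ^ (Z.to_nat j)
  else - c + be * tau ^ (Z.to_nat (- j - 1)).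
have phiP n : phi (Z.of_nat n) = c + (p - c) * rho ^ n.
  rewrite /phi; case: (Z.leb_spec 0 (Z.of_nat n)) => h; last lia.
  by rewrite Nat2Z.id.
have phiN n : phi (- Z.of_nat n - 1)%Z = - c + be * tau ^ n.
  rewrite /phi; case: (Z.leb_spec 0 (- Z.of_nat n - 1)) => h; first lia.
  by have -> : Z.to_nat (- (- Z.of_nat n - 1) - 1) = n by lia.
have cE : c * (1 - 2 * t) = 1 by rewrite /c; field; lra.
have pE : p * s = t ^ 2 * q by rewrite /p; field; lra.
(* [rhoE] is the characteristic equation of the recurrence for [phi]; [tauE] below is the same
   equation read towards negative [j]. *)
have rhoE : (1 - t) * rho = t * (1 - t) + t ^ 2 * rho ^ 2 by rewrite /rho; nra.
have tauM : (1 - t) * tau = t ^ 2 * q by rewrite /tau; field; lra.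
have tauE : (1 - t) * tau = t ^ 2 + t * (1 - t) * tau ^ 2.
  apply: (Rmult_eq_reg_l (1 - t)); last lra.
  have -> : (1 - t) * (t ^ 2 + t * (1 - t) * tau ^ 2)
    = (1 - t) * t ^ 2 + t * ((1 - t) * tau) ^ 2 by ring.
  rewrite tauM.
  have -> : (1 - t) * t ^ 2 + t * (t ^ 2 * q) ^ 2
    = t ^ 2 * (1 - t + t ^ 3 * q ^ 2) by ring.
  rewrite qE; ring.
have qtau : q * (1 - t * tau) = 1.
  apply: (Rmult_eq_reg_l (1 - t)); last lra.
  have -> : (1 - t) * (q * (1 - t * tau)) = (1 - t) * q - q * t * ((1 - t) * tau) by ring.
  rewrite tauM.
  have -> : (1 - t) * q - q * t * (t ^ 2 * q) = (1 - t) * q - t ^ 3 * q ^ 2 by ring.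
  rewrite qE; ring.
have rhoB : Rabs rho <= 1 by apply/Rabs_le; rewrite /rho; nra.
have tauB : Rabs tau <= 1.
  have tq : 0 <= t ^ 2 * q <= / 4 by split; nra.
  by apply/Rabs_le; split; nra.
(* The equation for [V false j] involves only [V false j] and [V true j]; solving it for the former
   leaves this equation in [phi] alone. *)
have phiE j : phi j = IZR (Z.sgn j) + t * phi (j - 1)%Z
     + t * ((IZR (Z.sgn (j + 1)) + t * phi (j + 1)%Z) / (1 - t)).
  apply: Rminus_diag_uniq.
  (* The cases are [j = 0], [j > 0], [j = -1], [j < -1]. In each, the difference of the two sides is
     regrouped into expressions that vanish by the relations above. *)
  have [[[|n]|[|n]] ->] : exists k : nat + nat, j = match k with
      | inl n => Z.of_nat n | inr n => (- Z.of_nat n - 1)%Z end.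
    case: (Z_le_gt_dec 0 j) => h; [exists (inl (Z.to_nat j)) | exists (inr (Z.to_nat (- j - 1)))]; lia.
  - have -> : (Z.of_nat 0 - 1 = - Z.of_nat 0 - 1)%Z by lia.
    have -> : (Z.of_nat 0 + 1 = Z.of_nat 1)%Z by lia.
    rewrite !phiP phiN.
    transitivity ((p * (1 - t - 2 * t ^ 3 * q) + c * (1 - 2 * t) * (t - t ^ 2 * q) - t) / (1 - t)).
      rewrite /be /rho /=; field; lra.
    rewrite -sE pE cE; field; lra.
  - have -> : (Z.of_nat n.+1 - 1 = Z.of_nat n)%Z by lia.
    have -> : Z.sgn (Z.of_nat n.+1) = 1%Z by lia.
    have -> : Z.sgn (Z.of_nat n.+1 + 1) = 1%Z by lia.
    have -> : (Z.of_nat n.+1 + 1 = Z.of_nat n.+2)%Z by lia.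
    rewrite !phiP.
    transitivity ((c * (1 - 2 * t) - 1 + (p - c) * rho ^ n
      * ((1 - t) * rho - (t * (1 - t) + t ^ 2 * rho ^ 2))) / (1 - t)).
      rewrite /=; field; lra.
    rewrite cE rhoE; field; lra.
  - have -> : (- Z.of_nat 0 - 1 - 1 = - Z.of_nat 1 - 1)%Z by lia.
    have -> : (- Z.of_nat 0 - 1 + 1 = Z.of_nat 0)%Z by lia.
    rewrite !phiN phiP.
    transitivity (t * (c + t * p / (1 - t)) * (q * (1 - t * tau) - 1) - (c * (1 - 2 * t) - 1)).
      rewrite /be /=; field; lra.
    rewrite qtau cE; ring.
  - have -> : (- Z.of_nat n.+1 - 1 - 1 = - Z.of_nat n.+2 - 1)%Z by lia.
    have -> : Z.sgn (- Z.of_nat n.+1 - 1) = (-1)%Z by lia.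
    have -> : Z.sgn (- Z.of_nat n.+1 - 1 + 1) = (-1)%Z by lia.
    have -> : (- Z.of_nat n.+1 - 1 + 1 = - Z.of_nat n - 1)%Z by lia.
    rewrite !phiN.
    transitivity ((1 - c * (1 - 2 * t) + be * tau ^ n
      * ((1 - t) * tau - (t ^ 2 + t * (1 - t) * tau ^ 2))) / (1 - t)).
      rewrite /=; field; lra.
    rewrite cE tauE; field; lra.
have [K phiB] : exists K, forall j, Rabs (phi j) <= K.
  have powB (x : R) n : Rabs x <= 1 -> Rabs (x ^ n) <= 1.
    move=> hx; rewrite -RPow_abs -(pow1 n).
    by apply: pow_incr; split; [exact: Rabs_pos|].
  exists (Rabs c + Rabs (p - c) + Rabs be) => j; rewrite /phi.
  have pc := Rabs_pos (p - c); have pb := Rabs_pos be.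
  case: ifP => _; apply: Rle_trans (Rabs_triang _ _) _; rewrite ?Rabs_Ropp Rabs_mult.
    have := powB rho (Z.to_nat j) rhoB; nra.
  have := powB tau (Z.to_nat (- j - 1)) tauB; nra.
exists (fun b j => if b then phi j else (IZR (Z.sgn j) + t * phi j) / (1 - t)).
exists (K + (1 + K) * 2).
split.
- have K0 : 0 <= K by apply: Rle_trans (Rabs_pos _) (phiB 0%Z).
  case=> j; first by have := phiB j; lra.
  have /Rabs_le_between phij := phiB j.
  have sgnB : -1 <= IZR (Z.sgn j) <= 1 by split; apply: IZR_le; lia.
  set y := _ / _.
  have yE : y * (1 - t) = IZR (Z.sgn j) + t * phi j by rewrite /y; field; lra.
  by apply/Rabs_le; split; nra.
- case=> j; rewrite /gap_step ?Z.add_0_r; last by field; lra.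
  by rewrite {1}phiE; have -> : (j + -1)%Z = (j - 1)%Z by []; ring.
- rewrite /= (phiP 0%nat) /p /=; field; lra.
Qed.

Theorem mainTheorem1 :
  exists r : R, (0 < r)%R /\
    forall t : R, (Rabs t < r)%R ->
      is_series (fun n : nat => (Delta_n n * pow (2 * t) n)%R)
        (/ 2 * / sqrt ((1 - t) * (1 - 2 * t) * (2 * pow t 2 + t + 1))
         - / 2 * / (1 - t))%R.
Proof.
(* The contraction needs [Rabs t < / 2]; the smaller radius also gives easy bounds on [rho] and
   [tau]. *)
exists (/ 4); split; first lra.
move=> t ht; have /Rabs_lt_between ht' := ht.
set D := (1 - t) * _ * _.
have D0 : 0 < D by rewrite /D; apply: Rmult_lt_0_compat; nra.
set s := sqrt D.
have s0 : 0 < s by exact: sqrt_lt_R0.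
have sD : s * s = (1 - t) * (1 - t - 4 * t ^ 3).
  rewrite sqrt_sqrt; [rewrite /D; ring | lra].
(* The root [(1 - t - s) / (2 * t ^ 3)] of [t ^ 3 * q ^ 2 = (1 - t) * (q - 1)], rationalised so that
   it makes sense at [t = 0], where it is 1. *)
pose q := 2 * (1 - t) / (1 - t + s).
have qd : q * (1 - t + s) = 2 * (1 - t) by rewrite /q; field; lra.
have qB : 0 < q <= 2 by split; nra.
have sE : s = 1 - t - 2 * t ^ 3 * q.
  apply: (Rmult_eq_reg_r (1 - t + s)); last lra.
  have -> : (1 - t - 2 * t ^ 3 * q) * (1 - t + s)
    = (1 - t) * (1 - t + s) - 2 * t ^ 3 * (q * (1 - t + s)) by ring.
  rewrite qd; nra.
have qE : t ^ 3 * q ^ 2 = (1 - t) * (q - 1).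
  rewrite {1}sE in qd; nra.
have [V [K [Vbnd Veq V0]]] := sign_potential t s q ht s0 qB sE qE.
have termE n : sign_sum false n 0 * t ^ n = Delta_n n * (2 * t) ^ n.
  by rewrite Delta_sign_sum Rpow_mult_distr; field; exact: pow_nonzero.
apply: (is_series_ext _ _ _ termE).
have -> : / 2 * / s - / 2 * / (1 - t) = V false 0%Z.
  rewrite V0; have -> : t ^ 3 * q = (1 - t - s) / 2 by rewrite {1}sE; field.
  field; lra.
by apply: (sign_sum_series t K V) => //; lra.
Qed.
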